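(* Let $\mathcal{H}$ be a hypergraph with incidence matrix $\mathbf{B}$ and cardinality matrix $\mathbf{C}$. If $\mathbf{A}_{\mathcal{L}}$ is the adjacency matrix of its line multigraph $\mathcal{L}(\mathcal{H})$, then $$\mathbf{B}^{\mathrm{T}}\mathbf{B} = \mathbf{C} + \mathbf{A}_{\mathcal{L}}.$$
   Context: A hypergraph $\mathcal{H}=(V,E)$ consists of a finite set $V$ of vertices and a set $E$ of non-empty subsets of $V$, called hyperedges. All hypergraphs are assumed simple (no hyperedge has cardinality one and no hyperedge is contained in another) and connected (any two vertices are joined by a path, i.e. an alternating sequence of distinct vertices and hyperedges in which each hyperedge contains the vertices immediately before and after it). The line multigraph $\mathcal{L}(\mathcal{H})$ is the multigraph with vertex set $E$ in which two distinct vertices $e,f\in E$ are joined by exactly $|e\cap f|$ edges (no loops). The adjacency matrix of a multigraph has zero diagonal, and for $u\neq v$ its $(u,v)$ entry is the number of edges joining $u$ and $v$. The incidence matrix $\mathbf{B}=\mathbf{B}(\mathcal{H})$ is the $|V|\times|E|$ matrix with entry $b_{ve}=1$ if $v\in e$ and $b_{ve}=0$ otherwise. The cardinality matrix $\mathbf{C}=\mathbf{C}(\mathcal{H})$ is the $|E|\times|E|$ diagonal matrix whose diagonal entry at $e$ is $|e|$. Rows and columns indexed by hyperedges use the same ordering throughout. *)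

(* Defs.v *)
From HB Require Import structures.
From mathcomp Require Import all_boot all_order all_algebra.

Set Implicit Arguments.
Unset Strict Implicit.
Unset Printing Implicit Defensive.

Import GRing.Theory.
Local Open Scope ring_scope.

Record hypergraph := Hypergraph {
  vertex : finType;
  hyperedges : {set {set vertex}};
  hyperedges_neq0 : set0 \notin hyperedges
}.

Definition hyperedge (H : hypergraph) : finType :=
  {e : {set vertex H} | e \in hyperedges H}.

Definition hyperedge_set (H : hypergraph) (e : hyperedge H) : {set vertex H} :=
  val e.

Definition simple_hypergraph (H : hypergraph) : Prop :=
  (forall e : {set vertex H}, e \in hyperedges H -> #|e| <> 1%N) /\
  (forall e f : {set vertex H},
     e \in hyperedges H -> f \in hyperedges H -> e \subset f -> e = f).

(* The alternating sequence x, e1, v1, ..., ek, vk is encoded as its first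
   vertex x together with the list (e1, v1), ..., (ek, vk). *)
Fixpoint hwalk (H : hypergraph) (x : vertex H)
    (p : seq (hyperedge H * vertex H)) : bool :=
  if p is (e, v) :: p' then
    [&& x \in hyperedge_set e, v \in hyperedge_set e & hwalk v p']
  else true.

Definition hpath (H : hypergraph) (x : vertex H)
    (p : seq (hyperedge H * vertex H)) : bool :=
  [&& hwalk x p, uniq (x :: unzip2 p) & uniq (unzip1 p)].

Definition connected_hypergraph (H : hypergraph) : Prop :=
  forall x y : vertex H,
    exists2 p : seq (hyperedge H * vertex H),
      hpath x p & last x (unzip2 p) = y.

(* A loopless multigraph on T, given by its edge multiplicities:
   [nb_edges u v] is the number of edges joining u and v. *)
Record multigraph (T : finType) := Multigraph {
  nb_edges : T -> T -> nat;
  nb_edges_sym : forall u v, nb_edges u v = nb_edges v u;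
  nb_edges_loopless : forall u, nb_edges u u = 0%N
}.

(* Matrices indexed by a finite type T are indexed by 'I_#|T| through the
   fixed enumeration [enum_val] of T. *)
Definition adjacency_mx (R : nzRingType) (T : finType) (G : multigraph T) :
    'M[R]_#|T| :=
  \matrix_(i, j) (if i == j then 0
                  else (nb_edges G (enum_val i) (enum_val j))%:R).

Definition line_mult (H : hypergraph) (e f : hyperedge H) : nat :=
  if e == f then 0%N else #|hyperedge_set e :&: hyperedge_set f|.

Lemma line_mult_sym (H : hypergraph) (e f : hyperedge H) :
  line_mult e f = line_mult f e.
Proof. by rewrite /line_mult eq_sym setIC. Qed.

Lemma line_mult_loopless (H : hypergraph) (e : hyperedge H) :
  line_mult e e = 0%N.
Proof. by rewrite /line_mult eqxx. Qed.

Definition line_multigraph (H : hypergraph) : multigraph (hyperedge H) :=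
  Multigraph (@line_mult_sym H) (@line_mult_loopless H).

Definition incidence_mx (R : nzRingType) (H : hypergraph) :
    'M[R]_(#|vertex H|, #|hyperedge H|) :=
  \matrix_(i, j) (if enum_val i \in hyperedge_set (enum_val j) then 1 else 0).

Definition cardinality_mx (R : nzRingType) (H : hypergraph) :
    'M[R]_#|hyperedge H| :=
  diag_mx (\row_j #|hyperedge_set (enum_val j)|%:R).

(* Main.v *)
Require Import Defs.
From mathcomp Require Import all_boot all_order all_algebra.

Import GRing.Theory.

Local Open Scope ring_scope.

(** Two columns of the incidence matrix are indicator vectors of hyperedges, so their dot product
    counts the common vertices ([incidence_gramE]). For equal hyperedges this count is the
    cardinality; for distinct ones it is the multiplicity in the line multigraph. *)

Lemma incidence_gramE (R : nzRingType) (H : hypergraph)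
    (i j : 'I_#|hyperedge H|) :
  ((incidence_mx R H)^T *m incidence_mx R H) i j =
  #|hyperedge_set (enum_val i) :&: hyperedge_set (enum_val j)|%:R.
Proof.
set e := hyperedge_set (enum_val i); set f := hyperedge_set (enum_val j).
have -> : #|e :&: f|%:R =
          \sum_(k < #|vertex H|) (if enum_val k \in e :&: f then 1 else 0 : R).
  (* Passes from row indices to the vertices they enumerate. *)
  rewrite -(big_enum_val (fun v => if v \in e :&: f then 1 else 0)).
  by rewrite -sum1_card natr_sum big_mkcond.
rewrite mxE; apply: eq_bigr => k _; rewrite !mxE -/e -/f inE.
by case: (_ \in e); rewrite ?mul0r ?mul1r.
Qed.

Theorem theorem4p3 (R : nzRingType) (H : hypergraph)
    (H_simple : simple_hypergraph H) (H_connected : connected_hypergraph H) :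
  (incidence_mx R H)^T *m incidence_mx R H =
  cardinality_mx R H + adjacency_mx R (line_multigraph H).
Proof.
apply/matrixP => i j; rewrite incidence_gramE !mxE /= /line_mult.
have [<-|ne_ij] := eqVneq i j; first by rewrite setIid mulr1n addr0.
(* [line_mult] compares hyperedges, not indices: injectivity of [enum_val] turns distinct indices
   into distinct hyperedges. *)
by rewrite (inj_eq enum_val_inj) (negPf ne_ij) mulr0n add0r.
Qed.
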